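(* Let $\mathcal{D}$ be a Steiner system $S(5,6,12)$ with point set $[12]$. The orbit $O(\mathcal{D})$ has $5040$ elements, and the game distribution $F_{\mathcal{D}}$ of $\mathcal{D}$ is nonzero exactly for $n=905,\dots,916$, with the following values: $F_{\mathcal{D}}(905)=1$, $F_{\mathcal{D}}(906)=10$, $F_{\mathcal{D}}(907)=42$, $F_{\mathcal{D}}(908)=150$, $F_{\mathcal{D}}(909)=351$, $F_{\mathcal{D}}(910)=650$, $F_{\mathcal{D}}(911)=1012$, $F_{\mathcal{D}}(912)=1237$, $F_{\mathcal{D}}(913)=939$, $F_{\mathcal{D}}(914)=532$, $F_{\mathcal{D}}(915)=115$, $F_{\mathcal{D}}(916)=1$. Moreover, $\Gamma_{12,6}[\bar{\mathcal{P}}(\mathcal{D}^{sh})]$ is the hexad game $\mathcal{H}$, and $\mathcal{D}^{sh}$ is the unique element $\mathcal{D}'\in O(\mathcal{D})$ with $|\bar{\mathcal{P}}(\mathcal{D}')|=905$, which is the minimum value.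
   Context: $[v]=\{0,\dots,v-1\}$. A Steiner system $S(t,k,v)$ with point set $[v]$ is a pair $([v],\mathcal{B})$ with $\mathcal{B}\subseteq\binom{[v]}{k}$ such that every $t$-subset of $[v]$ lies in exactly one block. Welter's game $\Gamma_{v,k}$ is the digraph on $\binom{[v]}{k}$ with edges $(P,P^{(p\,q)})$ for $q<p$, $p\in P$, $q\notin P$, where $P^{(p\,q)}=(P\setminus\{p\})\cup\{q\}$. For a block set $\mathcal{B}$ of $\mathcal{D}$, set $$\bar{\mathcal{P}}(\mathcal{D})=\mathcal{B}\cup\bigcup_{B\in\mathcal{B}}\{R:(R,B)\text{ is an edge of }\Gamma_{v,k}\}.$$ For $\pi\in\mathrm{Sym}([v])$, $\mathcal{D}^\pi=([v],\{B^\pi:B\in\mathcal{B}\})$. The orbit is $O(\mathcal{D})=\{\mathcal{D}^\pi:\pi\in\mathrm{Sym}([v])\}$, and the game distribution is $F_{\mathcal{D}}(n)=|\{\mathcal{D}'\in O(\mathcal{D}):|\bar{\mathcal{P}}(\mathcal{D}')|=n\}|$. The hexad game $\mathcal{H}$ is the subgraph of $\Gamma_{12,6}$ induced by $\{P\in\binom{[12]}{6}:\sum_{p\in P}p\ge 21\}$. Its $\mathsf{P}$-position set is the set of positions with outcome $\mathsf{P}$, where outcomes are defined recursively: a position is $\mathsf{N}$ if some out-neighbor is $\mathsf{P}$, and $\mathsf{P}$ otherwise. Let $\mathcal{D}^{sh}=([12],\mathsf{P}\text{-position set of }\mathcal{H})$. It is known that $\mathcal{D}^{sh}$ is an $S(5,6,12)$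 (the shuffle numbering), and that all $S(5,6,12)$ on $[12]$ are isomorphic, so $\mathcal{D}^{sh}\in O(\mathcal{D})$. *)

(* Defs.v *)
From mathcomp Require Import all_boot all_fingroup.

Set Implicit Arguments.
Unset Strict Implicit.
Unset Printing Implicit Defensive.

(* The point set [v] is 'I_v, and a design ([v], D) is identified with its
   block set D : {set {set 'I_v}}. *)

Definition is_steiner_system (t k v : nat) (D : {set {set 'I_v}}) : Prop :=
  (forall B, B \in D -> #|B| = k) /\
  (forall T : {set 'I_v}, #|T| = t -> exists! B, B \in D /\ T \subset B).

Record digraph (T : finType) := Digraph {
  vertices : {set T};
  edges : {set T * T}
}.

Definition induced_subgraph (T : finType) (G : digraph T) (S : {set T}) :
    digraph T :=
  {| vertices := vertices G :&: S;
     edges := [set e in edges G | (e.1 \in S) && (e.2 \in S)] |}.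

(* is_P G n x computes the outcome of x looking n moves ahead.  When G is
   acyclic, a play visits at most #|T| positions, so that n = #|T| gives the
   actual outcome; see P_positionsE. *)
Fixpoint is_P (T : finType) (G : digraph T) (n : nat) (x : T) : bool :=
  if n is m.+1 then ~~ [exists y, ((x, y) \in edges G) && is_P G m y]
  else true.

Definition P_positions (T : finType) (G : digraph T) : {set T} :=
  [set x in vertices G | is_P G #|T| x].

Definition welter_game (v k : nat) : digraph {set 'I_v} :=
  {| vertices := [set P : {set 'I_v} | #|P| == k];
     edges := [set e : {set 'I_v} * {set 'I_v} | (#|e.1| == k) &&
       [exists p in e.1, exists q,
         [&& q \notin e.1, q < p & e.2 == q |: (e.1 :\ p)]]] |}.

Definition bar_P (v k : nat) (D : {set {set 'I_v}}) : {set {set 'I_v}} :=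
  D :|: \bigcup_(B in D) [set R | (R, B) \in edges (welter_game v k)].

(* 'P^*^* is the natural action of permutations of points on block sets. *)
Definition design_orbit (v : nat) (D : {set {set 'I_v}}) :
    {set {set {set 'I_v}}} :=
  orbit 'P^*^* [set: 'S_v] D.

Definition game_distribution (v k : nat) (D : {set {set 'I_v}}) (n : nat) :
    nat :=
  #|[set D' in design_orbit D | #|bar_P k D'| == n]|.

Definition hexad_game : digraph {set 'I_12} :=
  induced_subgraph (welter_game 12 6)
    [set P : {set 'I_12} | (#|P| == 6) && (21 <= \sum_(p in P) p)].

Definition shuffle_design : {set {set 'I_12}} := P_positions hexad_game.

Lemma design_orbitE (v : nat) (D : {set {set 'I_v}}) :
  design_orbit D =
  [set [set [set s x | x in B] | B : {set 'I_v} in D] | s : 'S_v].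
Proof.
by apply/setP=> E; apply/imsetP/imsetP=> -[s _ ->]; exists s.
Qed.

Lemma P_positionsE (T : finType) (G : digraph T) (r : T -> nat) :
  (forall x y, (x, y) \in edges G ->
     [&& x \in vertices G, y \in vertices G & r y < r x]) ->
  forall x, x \in vertices G ->
    (x \in P_positions G) =
    ~~ [exists y, ((x, y) \in edges G) && (y \in P_positions G)].
Proof.
move=> dec; pose e := [rel x y | (x, y) \in edges G].
pose h x := #|[set y | connect e x y]|.
have le_r x y : connect e x y -> r y <= r x.
  case/connectP=> p; elim: p x => [|z p IHp] x /= => [_ -> //|].
  case/andP=> /dec/and3P[_ _ lt_zx] /IHp{}IHp /IHp le_yz.
  exact: leq_trans le_yz (ltnW lt_zx).
have lt_h x y : (x, y) \in edges G -> h y < h x.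
  move=> exy; apply/proper_card/properP; split.
    by apply/subsetP=> z; rewrite !inE; apply/connect_trans/connect1.
  exists x; rewrite !inE ?connect0 //; apply/negP=> /le_r.
  by case/and3P: (dec _ _ exy) => _ _; rewrite ltnNge => /negP.
have stable m : forall n x, h x <= m.+1 -> h x <= n.+1 ->
    is_P G m x = is_P G n x.
  have h_gt0 x : 0 < h x.
    by apply/card_gt0P; exists x; rewrite inE connect0.
  have no_move x : h x <= 1 -> forall y, (x, y) \in edges G = false.
    move=> h1 y; apply/negP=> /lt_h lt_yx.
    by have := leq_trans lt_yx h1; rewrite ltnS leqNgt h_gt0.
  elim: m => [|m IHm] [|n] x //= hm hn.
  - by apply/esym/existsP=> -[y]; rewrite no_move.
  - by apply/existsP=> -[y]; rewrite no_move.
  congr (~~ _); apply: eq_existsb => y.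
  case exy: (_ \in _) => //=; apply: IHm.
    by have := leq_trans (lt_h _ _ exy) hm.
  by have := leq_trans (lt_h _ _ exy) hn.
move=> x Gx; rewrite inE Gx /=.
have le_h : h x <= #|T| by apply: max_card.
have -> : is_P G #|T| x = is_P G #|T|.+1 x.
  by apply: stable; rewrite leqW // leqW.
congr (~~ _); apply: eq_existsb => y.
by case exy: (_ \in _); rewrite //= inE; case/and3P: (dec _ _ exy) => _ ->.
Qed.

Lemma shuffle_designE (P : {set 'I_12}) : P \in vertices hexad_game ->
  (P \in shuffle_design) =
  ~~ [exists Q, ((P, Q) \in edges hexad_game) && (Q \in shuffle_design)].
Proof.
apply: (@P_positionsE _ _ (fun Q : {set 'I_12} => \sum_(p in Q) p)) => {}P Q.
rewrite !inE /= => /andP[/andP[_ /exists_inP[p Pp /existsP[q]]]].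
case/and3P=> qP lt_qp /eqP-> /andP[/andP[-> ->] /andP[-> ->]] /=.
rewrite big_setU1 /=; last by rewrite !inE negb_and qP orbT.
by rewrite [X in _ < X](big_setD1 p) //= ltn_add2r.
Qed.

(* Main.v *)
(* Fix the points 0..4 and let H be the group of permutations of the seven
   remaining points.  M12 is sharply 5-transitive, so H acts regularly on the
   Steiner systems S(5,6,12): there are 7! = 5040 of them, and they are exactly
   the images by H of the shuffle design.

   Every system is a relabelling by H of the shuffle design: an exhaustive
   search adds, for each 5-subset in turn, the block that contains it, and as
   long as several points of 5..11 lie in no chosen block they are
   interchangeable, so that only one of them needs to be tried.  Regularity
   follows by testing the 5040 permutations of H.

   A 6-set s(A) neither lies in the image D^s of the shuffle design D nor has a
   move to a block of D^s iff A is not a block of D and s(p) < s(q) for every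
   block (A \ {p}) U {q} of D.  For s in H the pairs (p, q) that meet 0..4 rule
   out all but 51 of the sets A whatever s is, so |bar_P(D^s)| is 924 minus the
   number of true statements among 51 conjunctions of inequalities
   s(p) < s(q). *)

Require Import Defs.
From mathcomp Require Import all_boot all_fingroup.
From mathcomp Require Import zify.

Set Implicit Arguments.
Unset Strict Implicit.
Unset Printing Implicit Defensive.

(** * Subsets of an initial segment as bit masks *)

(* The k-subsets of 0..n-1 in colexicographic order. *)
Fixpoint masks (n k : nat) : seq bitseq :=
  match n, k with
  | 0, 0 => [:: [::]]
  | 0, _.+1 => [::]
  | n'.+1, 0 => [seq rcons m false | m <- masks n' 0]
  | n'.+1, k'.+1 => [seq rcons m false | m <- masks n' k] ++
                    [seq rcons m true | m <- masks n' k']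
  end.

Definition meet (a b : bitseq) : nat :=
  count (fun xy => xy.1 && xy.2) (zip a b).
Definition diff (a b : bitseq) : bitseq :=
  [seq xy.1 && ~~ xy.2 | xy <- zip a b].
Definition add (x : nat) (a : bitseq) : bitseq := set_nth false a x true.
Definition points (a : bitseq) : seq nat := mask a (iota 0 (size a)).
(** Bit [i] of the result is bit [w_i] of [a]: if [w] lists the values of a permutation, this is the
    preimage of the set, so no inverse has to be computed. *)
Definition relabel (w : seq nat) (a : bitseq) : bitseq :=
  [seq nth false a j | j <- w].

Lemma mem_map_rcons (T : eqType) (s : seq (seq T)) (m : seq T) (b c : T) :
  (rcons m b \in [seq rcons x c | x <- s]) = (b == c) && (m \in s).
Proof.
apply/mapP/andP => [[x sx /rcons_inj[-> ->]]|[/eqP-> sm]]; first by [].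
by exists m.
Qed.

Lemma mem_masks (n k : nat) (m : bitseq) :
  (m \in masks n k) = (size m == n) && (count id m == k).
Proof.
elim: n k m => [|n IHn] [|k] m.
- by case: m.
- by case: m.
- case/lastP: m => [|m b] /=.
    by apply/negP => /mapP[x _ /(congr1 size)]; rewrite size_rcons.
  rewrite mem_map_rcons IHn size_rcons eqSS -cats1 count_cat /= addn0.
  by case: b; rewrite ?addn0 // addn1 andbF.
- case/lastP: m => [|m b].
    by apply/negP; rewrite mem_cat => /orP[] /mapP[x _ /(congr1 size)];
      rewrite size_rcons.
  rewrite mem_cat !mem_map_rcons !IHn size_rcons eqSS -cats1 count_cat /= addn0.
  by case: b; rewrite /= ?orbF ?addn0 // addn1 eqSS.
Qed.

Lemma masks_uniq (n k : nat) : uniq (masks n k).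
Proof.
have inj b : injective (fun m : bitseq => rcons m b) by move=> ? ? /rcons_inj[].
elim: n k => [|n IHn] [|k] //=; first by rewrite map_inj_uniq.
rewrite cat_uniq !map_inj_uniq // !IHn andbT; apply/hasPn => m /mapP[x _ ->].
by rewrite mem_map_rcons.
Qed.

Section MaskOf.
Variable n : nat.
Implicit Types (A B : {set 'I_n}) (i : 'I_n) (s : 'S_n).

Definition mask_of A : bitseq := [seq i \in A | i <- enum 'I_n].
Definition values s : seq nat := [seq val (s i) | i <- enum 'I_n].

Lemma size_mask_of A : size (mask_of A) = n.
Proof. by rewrite size_map size_enum_ord. Qed.

Lemma nth_mask_of A i : nth false (mask_of A) i = (i \in A).
Proof. by rewrite (nth_map i) ?nth_ord_enum // size_enum_ord. Qed.

Lemma mask_of_inj : injective mask_of.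
Proof. by move=> A B eqAB; apply/setP => i; rewrite -!nth_mask_of eqAB. Qed.

Lemma count_enum (P : pred 'I_n) : count P (enum 'I_n) = #|[set i | P i]|.
Proof.
rewrite cardE -size_filter; congr size.
rewrite /enum_mem -enumT -filter_predI; apply: eq_filter => i.
by rewrite !inE andbT.
Qed.

Lemma count_mask_of A : count id (mask_of A) = #|A|.
Proof. by rewrite count_map count_enum; apply: eq_card => i; rewrite inE. Qed.

Lemma mask_ofP (m : bitseq) : size m = n -> exists A, m = mask_of A.
Proof.
move=> sz_m; exists [set i : 'I_n | nth false m i].
apply: (@eq_from_nth _ false) => [|i]; rewrite sz_m ?size_mask_of // => lt_in.
by rewrite (nth_mask_of _ (Ordinal lt_in)) inE.
Qed.

Lemma mask_of_masks A k : (mask_of A \in masks n k) = (#|A| == k).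
Proof. by rewrite mem_masks size_mask_of eqxx count_mask_of. Qed.

(** [mask_of] is a bijection from the k-subsets onto [masks n k]; this turns cardinalities into
    counts that can be evaluated. *)
Lemma card_masks k (P : pred bitseq) :
  #|[set A : {set 'I_n} | (#|A| == k) && P (mask_of A)]| = count P (masks n k).
Proof.
rewrite cardE -(size_map mask_of) -size_filter; apply: perm_size.
apply: uniq_perm; rewrite ?filter_uniq ?masks_uniq //.
  by rewrite map_inj_uniq ?enum_uniq //; apply: mask_of_inj.
move=> m; rewrite mem_filter; apply/mapP/andP => [[A]|[Pm]].
  by rewrite mem_enum inE => /andP[cardA PA] ->; rewrite mask_of_masks.
move=> m_k; have := m_k; rewrite mem_masks => /andP[/eqP/mask_ofP[A def_m] _].
exists A; rewrite // mem_enum inE -def_m Pm andbT.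
by rewrite -mask_of_masks -def_m.
Qed.

Lemma meet_mask_of A B : meet (mask_of A) (mask_of B) = #|A :&: B|.
Proof.
rewrite /meet zip_map count_map count_enum; apply: eq_card => i.
by rewrite !inE.
Qed.

Lemma diff_mask_of A B : diff (mask_of A) (mask_of B) = mask_of (A :\: B).
Proof.
by rewrite /diff zip_map -map_comp; apply: eq_map => i /=; rewrite inE andbC.
Qed.

Lemma add_mask_of A i : add i (mask_of A) = mask_of (i |: A).
Proof.
have sz : size (add i (mask_of A)) = n.
  by rewrite size_set_nth size_mask_of; apply/maxn_idPr.
apply: (@eq_from_nth _ false) => [|j]; rewrite sz ?size_mask_of // => lt_jn.
rewrite nth_set_nth /= (nth_mask_of _ (Ordinal lt_jn)).
by rewrite (nth_mask_of _ (Ordinal lt_jn)) !inE -val_eqE /=; case: eqP.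
Qed.

Lemma points_mask_of A : points (mask_of A) = [seq val i | i <- enum A].
Proof.
rewrite /points size_mask_of -val_enum_ord -map_mask -filter_mask.
by congr map; rewrite [in RHS]/enum_mem -enumT.
Qed.

Lemma sumn_points_mask_of A : sumn (points (mask_of A)) = \sum_(i in A) i.
Proof. by rewrite points_mask_of sumnE big_map big_enum. Qed.

Lemma relabel_mask_of s B :
  relabel (values s) (mask_of B) = mask_of (s @^-1: B).
Proof.
rewrite /relabel /values -map_comp; apply: eq_map => i /=.
by rewrite nth_mask_of inE.
Qed.

Lemma nth_values s i : nth 0 (values s) i = s i.
Proof. by rewrite (nth_map i) ?nth_ord_enum // size_enum_ord. Qed.

Lemma values_inj : injective values.
Proof.
move=> s t eq_st; apply/permP => i; apply: val_inj.
by rewrite /= -!nth_values eq_st.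
Qed.

(** * Designs, their relabellings, and Steiner systems *)

Definition design_of (C : seq bitseq) : {set {set 'I_n}} :=
  [set B | mask_of B \in C].

Lemma preimset_permK s B : s^-1%g @^-1: (s @^-1: B) = B.
Proof. by apply/setP => x; rewrite !inE permKV. Qed.

Lemma preimset_permKV s B : s @^-1: (s^-1%g @^-1: B) = B.
Proof. by apply/setP => x; rewrite !inE permK. Qed.

Lemma preimset_perm_inj s : injective (fun B : {set 'I_n} => s @^-1: B).
Proof.
move=> A B /setP eqAB; apply/setP => x; have := eqAB (s^-1%g x).
by rewrite !inE permKV.
Qed.

Lemma preimset_perm1 s i : s @^-1: [set s i] = [set i].
Proof. by apply/setP => x; rewrite !inE (inj_eq perm_inj). Qed.

Lemma card_preimset_perm s B : #|s @^-1: B| = #|B|.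
Proof. by apply/card_preimset/perm_inj. Qed.

Lemma mem_act_design s (D : {set {set 'I_n}}) B :
  (B \in 'P^*^*%act D s) = (s @^-1: B \in D).
Proof.
apply/imsetP/idP => [[A DA def_B]|DA].
  suff -> : s @^-1: B = A by [].
  by apply/setP => x; rewrite inE def_B /= (mem_imset _ _ (@perm_inj _ s)).
exists (s @^-1: B) => //; apply/setP => x; rewrite -(permKV s x).
by rewrite (mem_imset _ _ (@perm_inj _ s)) inE.
Qed.

Lemma steiner_act t k (D : {set {set 'I_n}}) s :
  is_steiner_system t k D -> is_steiner_system t k ('P^*^*%act D s).
Proof.
case=> cardD coverD; split=> [B|T cardT].
  by rewrite mem_act_design => /cardD; rewrite card_preimset_perm.
have [|B [[DB sTB] uniqB]] := coverD (s @^-1: T).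
  by rewrite card_preimset_perm.
exists (s^-1%g @^-1: B); split=> [|B' []].
  rewrite mem_act_design preimset_permKV; split=> //.
  by rewrite -[T](preimset_permK s); apply: preimsetS.
rewrite mem_act_design => DB' sTB'.
rewrite (uniqB (s @^-1: B')) ?preimset_permK //.
by split=> //; apply: preimsetS.
Qed.

Section Steiner.
Variables (t : nat) (D : {set {set 'I_n}}).
Hypothesis steinerD : is_steiner_system t t.+1 D.

Lemma steiner_extend (T : {set 'I_n}) :
  #|T| = t -> exists2 x, x \notin T & x |: T \in D.
Proof.
case: steinerD => cardD coverD cardT; have [B [[DB sTB] _]] := coverD T cardT.
have /cards1P[x def_x] : #|B :\: T| == 1.
  by rewrite cardsD (setIidPr sTB) cardT (cardD _ DB) subSnn.
have /setDP[xB xT] : x \in B :\: T by rewrite def_x set11.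
exists x => //; suff -> : x |: T = B by [].
by rewrite -def_x setUC -{1}(setIidPr sTB) setID.
Qed.

Lemma steiner_meet A B : A \in D -> B \in D -> t <= #|A :&: B| -> A = B.
Proof.
case: steinerD => cardD coverD DA DB; rewrite leq_eqVlt => /predU1P[card_t|].
  have [C [_ uniqC]] := coverD _ (esym card_t).
  by rewrite -(uniqC A) ?(uniqC B) //; split=> //; rewrite (subsetIr, subsetIl).
move=> card_gt; apply/eqP.
rewrite eqEcard (cardD A) // (cardD B) // leqnn andbT.
apply/setIidPl/eqP; rewrite eqEcard subsetIl (cardD A) //.
Qed.

(** Removing a point from a block [B] of [D] leaves a t-set; the member of [C] that contains it
    shares t points with [B], hence is [B]. Thus a list of blocks can be identified with a system
    once it is contained in it and covers all t-sets. *)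
Lemma steiner_cover_eq (C : {set {set 'I_n}}) :
  C \subset D ->
  (forall T : {set 'I_n}, #|T| = t -> exists2 B, B \in C & T \subset B) ->
  C = D.
Proof.
move=> sCD coverC; apply/eqP; rewrite eqEsubset sCD; apply/subsetP => B DB.
have cardB := steinerD.1 _ DB.
have /card_gt0P[x xB] : 0 < #|B| by rewrite cardB.
have [|A CA sBA] := coverC (B :\ x).
  by move: cardB; rewrite (cardsD1 x) xB => -[].
rewrite -(steiner_meet (subsetP sCD A CA) DB) //.
have -> : t = #|B :\ x| by move: cardB; rewrite (cardsD1 x) xB => -[].
by apply/subset_leq_card; rewrite subsetI sBA subD1set.
Qed.
End Steiner.
End MaskOf.

(** * Uniqueness of the Steiner system *)

Definition hexads : seq bitseq := [seq m <- masks 12 6 | 21 <= sumn (points m)].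

(* Two 6-sets are joined by a move iff they have five common points, and moves
   decrease the colexicographic rank: the greedy choice yields the
   P-positions. *)
Definition shuffle_blocks : seq bitseq := Eval lazy in
  foldl (fun C b => if has (fun c => 5 <= meet b c) C then C else b :: C)
    [::] hexads.

Local Notation shuffle_blockset := (design_of 12 shuffle_blocks).

Lemma shuffle_blocks_hexads : all (mem hexads) shuffle_blocks.
Proof. by lazy. Qed.

Lemma shuffle_blocks_cover :
  all (fun m => has (fun b => 5 <= meet m b) shuffle_blocks) (masks 12 5).
Proof. by lazy. Qed.

(** A move between 6-sets keeps five points and lowers the sum, so this is the recursion that
    defines the P-positions, with the listed blocks in their place. *)
Lemma shuffle_blocks_kernel :
  all (fun m => (m \in shuffle_blocks) ==
    ~~ has (fun b => (meet m b == 5) && (sumn (points b) < sumn (points m)))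
      shuffle_blocks) hexads.
Proof. by lazy. Qed.

(* Checks that each system containing the blocks C is a relabelling of [blocks].
   Ts lists the sets whose block is still to be chosen, ws the relabellings to
   be tried at the leaves, and Fr points that lie in no block of C.  Those of
   them outside T are interchangeable, so only the first one is tried. *)
Fixpoint search (blocks : seq bitseq) (ws : seq (seq nat)) (Ts C : seq bitseq)
    (Fr : seq nat) : bool :=
  if Ts is T :: Ts' then
    if has (fun c => 5 <= meet T c) C then search blocks ws Ts' C Fr else
    let Fr' := [seq x <- Fr | ~~ nth false T x] in
    all (fun x =>
      if [|| nth false T x, x \in behead Fr' |
             has (fun c => 5 <= meet (add x T) c) C]
      then true else search blocks ws Ts' (add x T :: C) (rem x Fr'))
      (iota 0 (size T))
  else has (fun w => all (fun b => relabel w b \in C) blocks) ws.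

(* In colexicographic order the search has 6 leaves, one for each of the
   relabellings listed here; in lexicographic order it would have 48. *)
Lemma search_shuffle :
  search shuffle_blocks
    [seq iota 0 5 ++ w | w <-
      [:: [:: 9; 7; 8; 10; 5; 6; 11]; [:: 6; 5; 10; 7; 8; 9; 11];
          [:: 7; 9; 5; 6; 10; 8; 11]; [:: 8; 10; 9; 5; 6; 7; 11];
          [:: 10; 8; 6; 9; 7; 5; 11]; [:: 5; 6; 7; 8; 9; 10; 11]]]
    (masks 12 5) [::] (rev (iota 5 7)).
Proof. by lazy. Qed.

(** The seven points that are not fixed in advance: [Sym late] is the group H. *)
Definition late : {set 'I_12} := [set i : 'I_12 | 4 < i].
Definition late_values : seq (seq nat) :=
  [seq iota 0 5 ++ w | w <- permutations (iota 5 7)].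

Lemma card_late : #|late| = 7.
Proof. by rewrite -count_enum -(count_map val (ltn 4)) val_enum_ord. Qed.

Lemma late_fix (s : 'S_12) (i : 'I_12) : s \in Sym late -> i < 5 -> s i = i.
Proof.
by rewrite inE => late_s ?; apply: out_perm late_s _; rewrite inE -leqNgt.
Qed.

Lemma perm_values (s : 'S_12) : perm_eq (values s) (iota 0 12).
Proof.
rewrite -val_enum_ord /values (map_comp val s) perm_map //.
apply: uniq_perm; rewrite ?(map_inj_uniq (@perm_inj _ s)) ?enum_uniq //.
move=> i; rewrite mem_enum; apply/mapP; exists (s^-1%g i); rewrite ?mem_enum //.
by rewrite permKV.
Qed.

Lemma values_late (s : 'S_12) : s \in Sym late -> values s \in late_values.
Proof.
have size_values : size (values s) = 12 by rewrite size_map size_enum_ord.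
move=> late_s; have take_values : take 5 (values s) = iota 0 5.
  apply: (@eq_from_nth _ 0) => [|i].
    by rewrite size_takel ?size_values.
  rewrite size_takel ?size_values // => lt_i5; rewrite nth_take //.
  have lt_i12 : i < 12 by lia.
  by rewrite (nth_values s (Ordinal lt_i12)) late_fix // nth_iota.
apply/mapP; exists (drop 5 (values s)).
  2: by rewrite -take_values cat_take_drop.
rewrite mem_permutations -(perm_cat2l (iota 0 5)) -{1}take_values cat_take_drop.
exact: perm_values.
Qed.

(** Both lists are free of duplicates and have 7! entries, so one inclusion is enough. *)
Lemma perm_late_values :
  perm_eq [seq values s | s <- enum (Sym late)] late_values.
Proof.
have inj_cat : injective (cat (iota 0 5)).
  by move=> u v /eqP; rewrite eqseq_cat // => /andP[_ /eqP].
have u1 : uniq [seq values s | s <- enum (Sym late)].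
  by rewrite map_inj_uniq ?enum_uniq //; apply: values_inj.
have sub : {subset [seq values s | s <- enum (Sym late)] <= late_values}.
  by move=> _ /mapP[s + ->]; rewrite mem_enum; apply: values_late.
have [|_ eq_mem] := uniq_min_size u1 sub.
  by rewrite !size_map -cardE card_Sym card_late size_permutations.
have u2 : uniq late_values by rewrite (map_inj_uniq inj_cat) permutations_uniq.
exact: uniq_perm u1 u2 eq_mem.
Qed.

Lemma late_valuesP (w : seq nat) :
  w \in late_values -> exists2 s, s \in Sym late & w = values s.
Proof.
rewrite -(perm_mem perm_late_values) => /mapP[s].
by rewrite mem_enum; exists s.
Qed.

Lemma preim_tperm_id (n : nat) (x y : 'I_n) (A : {set 'I_n}) :
  x \notin A -> y \notin A -> tperm x y @^-1: A = A.
Proof.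
move=> xA yA; apply/setP => z; rewrite inE.
by case: tpermP => [->|->|] //; rewrite (negPf xA) (negPf yA).
Qed.

Lemma shuffle_cover (T : {set 'I_12}) :
  #|T| = 5 -> exists2 B, B \in shuffle_blockset & T \subset B.
Proof.
move=> cardT; have := allP shuffle_blocks_cover (mask_of T).
rewrite mask_of_masks cardT eqxx => /(_ isT)/hasP[b blk_b].
have := allP shuffle_blocks_hexads b blk_b.
rewrite inE mem_filter mem_masks => /andP[_ /andP[/eqP/mask_ofP[B def_b] _]].
rewrite def_b meet_mask_of => le5; exists B; first by rewrite inE -def_b.
by apply/setIidPl/eqP; rewrite eqEcard subsetIl cardT.
Qed.

(** Induction on [Ts], for all systems [D] at once: when the search skips a point as interchangeable
    with another, the induction hypothesis is applied to the image of [D] under a transposition. *)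
Lemma search_sound blocks ws Ts (Cs : seq {set 'I_12}) Fr D :
  (forall T : {set 'I_12}, #|T| = 5 ->
     exists2 B, B \in design_of 12 blocks & T \subset B) ->
  {subset ws <= late_values} -> {subset Ts <= masks 12 5} ->
  search blocks ws Ts [seq mask_of A | A <- Cs] Fr ->
  uniq Fr -> {in Fr, forall x, 4 < x < 12} ->
  {in Cs, forall (A : {set 'I_12}) (i : 'I_12), i \in A -> val i \notin Fr} ->
  is_steiner_system 5 6 D -> {subset Cs <= D} ->
  exists2 s, s \in Sym late & design_of 12 blocks = 'P^*^*%act D s.
Proof.
move=> cover ws_late; elim: Ts Cs Fr D => [|T Ts IHTs] Cs Fr D Ts5 /=.
  (* At a leaf the preimage under [s] of every listed block is in [Cs], hence in [D]. So the listed
     blocks lie in the image of [D] under [s], and they cover all 5-sets. *)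
  case/hasP=> w /ws_late/late_valuesP[s late_s ->] /allP sub_s _ _ _.
  move=> steinerD CD.
  exists s => //; apply: (steiner_cover_eq (steiner_act s steinerD)).
    apply/subsetP => B; rewrite inE mem_act_design => /(sub_s _) /=.
    rewrite relabel_mask_of mem_map; last exact: mask_of_inj.
    exact: CD.
  exact: cover.
have T5 : T \in masks 12 5 by apply: Ts5; rewrite mem_head.
have {}Ts5 : {subset Ts <= masks 12 5}.
  by move=> m mTs; apply: Ts5; rewrite inE mTs orbT.
case: ifP => [_ /IHTs|]; first exact.
move: T5; rewrite mem_masks => /andP[/eqP/mask_ofP[A ->]].
rewrite count_mask_of => /eqP cardA uncovered.
set Fr' := filter _ _ => ok_all uniqFr Fr_late Fr_free steinerD CD.
have uncov B : B \in Cs -> #|A :&: B| < 5.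
  move=> CB; move/negbT/hasPn: uncovered => /(_ (mask_of B)).
  by rewrite meet_mask_of -ltnNge; apply; apply: map_f.
(* Let [x] complete [A] to a block of [D]. If the search skips [x] as a free point, [t] exchanges it
   with the first free point outside [A]; neither point lies in a set of [Cs], so these sets are
   fixed. Otherwise [t] is the identity. *)
have [t [late_t [x [xA Ax xFr CDt]]]] : exists t, t \in Sym late /\
    exists x, [/\ x \notin A, x |: A \in 'P^*^*%act D t, val x \notin behead Fr'
              & {subset Cs <= 'P^*^*%act D t}].
  have [x xA DAx] := steiner_extend steinerD cardA.
  have [xFr|xFr] := boolP (val x \in behead Fr'); last first.
    by exists 1%g; split; [exact: group1 | exists x; rewrite act1].
  case def_Fr': Fr' xFr => [|h Fr1] //= xFr.
  have hFr' : h \in Fr' by rewrite def_Fr' mem_head.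
  have xFr' : val x \in Fr' by rewrite def_Fr' inE xFr orbT.
  move: hFr' xFr'; rewrite !mem_filter => /andP[hA hFr] /andP[_ xFr0].
  have /andP[lt4h lth] := Fr_late _ hFr; pose y : 'I_12 := Ordinal lth.
  have /andP[lt4x _] := Fr_late _ xFr0.
  have yA : y \notin A by rewrite -nth_mask_of.
  have nxy : x != y.
    apply: contraTneq xFr => ->; have : uniq Fr' by rewrite filter_uniq.
    by rewrite def_Fr' => /andP[].
  exists (tperm x y); split.
    rewrite inE; apply: subset_trans (tperm_on x y) _.
    by apply/subsetP => z; rewrite !inE => /orP[] /eqP->.
  exists y; split=> //.
  - rewrite mem_act_design; suff -> : tperm x y @^-1: (y |: A) = x |: A by [].
    apply/setP => z; rewrite !inE.
    case: tpermP => [->|->|/eqP/negPf-> /eqP/negPf->] //.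
    + by rewrite !eqxx.
    + by rewrite (negPf xA) (negPf yA) !orbF eq_sym.
  - have : uniq Fr' by rewrite filter_uniq.
    by rewrite def_Fr' => /andP[].
  - move=> B CB; rewrite mem_act_design preim_tperm_id; first exact: CD.
      by apply: contraL xFr0; apply: Fr_free.
    by apply: contraL (hFr); apply: (Fr_free _ CB y).
have steinerDt := steiner_act t steinerD.
have cardAx : A :&: (x |: A) = A by apply/setIidPl/subsetUr.
move: ok_all => /allP/(_ (val x)).
rewrite size_mask_of mem_iota ltn_ord => /(_ isT) /=.
rewrite nth_mask_of (negPf xA) (negPf xFr) /= add_mask_of.
(* The search does not reject this point: a chosen block with five points in common with the new
   block would equal it and so contain [A], which no chosen block does. *)
rewrite ifN; last first.
  apply/hasPn => _ /mapP[B CB ->]; rewrite meet_mask_of.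
  apply/negP => /(steiner_meet steinerDt Ax (CDt B CB)) def_B.
  by have := uncov _ CB; rewrite -def_B cardAx cardA.
move=> search_x.
have [||||s late_s ->] :=
  IHTs ((x |: A) :: Cs) _ _ Ts5 search_x _ _ _ steinerDt.
- by rewrite rem_uniq // filter_uniq.
- by move=> z /mem_rem; rewrite mem_filter => /andP[_ /Fr_late].
- move=> B; rewrite inE => /predU1P[->|CB] i.
    rewrite rem_filter ?filter_uniq // mem_filter /= !inE => /predU1P[->|iA].
      by rewrite eqxx.
    by rewrite mem_filter nth_mask_of iA andbF.
  move=> iB; apply: contra (Fr_free _ CB i iB) => /mem_rem.
  by rewrite mem_filter => /andP[].
- by move=> B; rewrite inE => /predU1P[->|/CDt].
by exists (t * s)%g; rewrite ?groupM // actM.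
Qed.

Lemma steiner_shuffle D : is_steiner_system 5 6 D ->
  exists2 s, s \in Sym late & shuffle_blockset = 'P^*^*%act D s.
Proof.
move=> steinerD.
apply: (search_sound (Cs := [::]) shuffle_cover _ _ search_shuffle) => //.
- move=> w /mapP[v v_in ->]; apply: map_f; rewrite mem_permutations.
  by move: v v_in; apply/allP; lazy.
- by move=> x; rewrite mem_rev mem_iota; lia.
Qed.

(** * The hexad game *)

(** Describing a move by the two set differences makes it easy to transport along preimages under a
    permutation. *)
Lemma welter_edgeP (v k : nat) (A B : {set 'I_v}) :
  reflect
    [/\ #|A| = k, #|B| = k &
     exists p q, [/\ A :\: B = [set p], B :\: A = [set q] & q < p]]
    ((A, B) \in edges (welter_game v k)).
Proof.
rewrite inE /=; apply: (iffP andP).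
  case=> /eqP cardA /exists_inP[p Ap /existsP[q /and3P[Aq lt_qp /eqP->]]].
  have npq : p != q by apply: contraTneq lt_qp => ->; rewrite ltnn.
  split=> //.
    rewrite cardsU1 !inE (negPf Aq) andbF /=.
    by move: cardA; rewrite (cardsD1 p) Ap.
  exists p, q; split=> //; apply/setP => x; rewrite !inE.
    have [->|nxq] := eqVneq x q; first by rewrite (negPf Aq) eq_sym (negPf npq).
    by case: (eqVneq x p) => [->|] /=; rewrite ?Ap ?andNb.
  have [->|nxq] := eqVneq x q; first by rewrite Aq.
  by case: (x \in A); rewrite ?andbF.
case=> cardA cardB [p [q [AB BA lt_qp]]]; split; first exact/eqP.
have /setDP[Ap Bp] : p \in A :\: B by rewrite AB set11.
have /setDP[Bq Aq] : q \in B :\: A by rewrite BA set11.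
apply/exists_inP; exists p => //; apply/existsP; exists q.
rewrite Aq lt_qp /=; apply/eqP/setP => x; rewrite !inE.
have := congr1 (fun X : {set _} => x \in X) AB.
have := congr1 (fun X : {set _} => x \in X) BA; rewrite !inE.
by case: (x \in A); case: (x \in B) => /= <- <-.
Qed.

Lemma set_diff_sum (v : nat) (A B : {set 'I_v}) (p q : 'I_v) (f : 'I_v -> nat) :
  A :\: B = [set p] -> B :\: A = [set q] ->
  \sum_(i in A) f i + f q = \sum_(i in B) f i + f p.
Proof.
move=> AB BA; rewrite (big_setID B) /= AB big_set1.
rewrite [in RHS](big_setID A) /= BA big_set1.
by rewrite setIC addnAC.
Qed.

Lemma card_diff_set1 (v k : nat) (A B : {set 'I_v}) :
  #|A| = k.+1 -> #|A :&: B| = k -> exists p, A :\: B = [set p].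
Proof. by move=> cA cAB; apply/cards1P; rewrite cardsD cA cAB subSnn. Qed.

(** Exchanging [p] for [q] changes the sum of the points by [q - p], so the sums decide the
    direction of the move. *)
Lemma welter_edgeE (v k : nat) (A B : {set 'I_v}) :
  ((A, B) \in edges (welter_game v k.+1)) =
  [&& #|A| == k.+1, #|B| == k.+1, #|A :&: B| == k &
      \sum_(i in B) i < \sum_(i in A) i].
Proof.
apply/welter_edgeP/and4P => [[cardA cardB [p [q [AB BA lt_qp]]]]|[]].
  have eq_sum := set_diff_sum (@nat_of_ord v) AB BA.
  have : #|A :\: B| = 1 by rewrite AB cards1.
  rewrite cardsD cardA cardB eqxx; split=> //; [apply/eqP|]; first lia.
  by rewrite -(ltn_add2r q) eq_sum ltn_add2l.
move=> /eqP cardA /eqP cardB /eqP cardI lt_BA; split=> //.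
have [p AB] := card_diff_set1 cardA cardI.
have [q BA] : exists q, B :\: A = [set q].
  by apply: card_diff_set1 cardB _; rewrite setIC; exact: cardI.
exists p, q; split=> //; rewrite -(ltn_add2l (\sum_(i in B) i)).
by rewrite -(set_diff_sum (@nat_of_ord v) AB BA) ltn_add2r.
Qed.

Lemma mem_bar_P (v k : nat) (D : {set {set 'I_v}}) R :
  (R \in bar_P k D) =
  (R \in D) || [exists B in D, (R, B) \in edges (welter_game v k)].
Proof.
rewrite inE; congr orb; apply/bigcupP/exists_inP => [[B DB]|[B DB RB]].
  by rewrite inE; exists B.
by exists B => //; rewrite inE.
Qed.

Lemma mem_hexads (A : {set 'I_12}) :
  (mask_of A \in hexads) = (#|A| == 6) && (21 <= \sum_(p in A) p).
Proof. by rewrite mem_filter mask_of_masks sumn_points_mask_of andbC. Qed.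

Lemma mem_hexad_game (A : {set 'I_12}) :
  (A \in vertices hexad_game) = (#|A| == 6) && (21 <= \sum_(p in A) p).
Proof. by rewrite !inE; case: eqP. Qed.

Lemma hexad_edgeE (A B : {set 'I_12}) :
  ((A, B) \in edges hexad_game) =
  [&& (A, B) \in edges (welter_game 12 6), A \in vertices hexad_game
    & B \in vertices hexad_game].
Proof. by rewrite inE /= !mem_hexad_game !inE. Qed.

Lemma shuffle_blockset_hexad B :
  B \in shuffle_blockset -> B \in vertices hexad_game.
Proof.
rewrite inE => /(allP shuffle_blocks_hexads); rewrite /= mem_hexads.
by rewrite mem_hexad_game.
Qed.

Lemma shuffle_design_hexad (A : {set 'I_12}) :
  A \in shuffle_design -> A \in vertices hexad_game.
Proof. by rewrite /shuffle_design inE => /andP[]. Qed.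

(** Every move lowers the sum of the points. Induction on this sum shows that the two families
    agree, since they satisfy the same recursion on the hexads. *)
Lemma shuffle_design_blocks : shuffle_design = shuffle_blockset.
Proof.
apply/setP => A; move: {2}_.+1 (ltnSn (\sum_(i in A) i)) => m.
elim: m A => // m IHm A le_m.
have [A_hex|nA_hex] := boolP (A \in vertices hexad_game); last first.
  rewrite (contraNF (@shuffle_design_hexad A) nA_hex).
  by rewrite (contraNF (@shuffle_blockset_hexad A)).
rewrite shuffle_designE // [RHS]inE.
have A_hexads : mask_of A \in hexads by rewrite mem_hexads -mem_hexad_game.
rewrite (eqP (allP shuffle_blocks_kernel _ A_hexads)); congr (~~ _).
apply/existsP/hasP => [[B /andP[]]|[b bb /andP[]]].
  rewrite hexad_edgeE welter_edgeE => /and3P[/and4P[_ _ cardI lt_BA] _ _].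
  rewrite IHm; last exact: leq_trans lt_BA le_m.
  rewrite inE => BB; exists (mask_of B) => //.
  by rewrite meet_mask_of !sumn_points_mask_of cardI.
have /mask_ofP[B def_b] : size b = 12.
  have := allP shuffle_blocks_hexads b bb.
  by rewrite inE mem_filter mem_masks => /and3P[_ /eqP].
have BB : B \in shuffle_blockset by rewrite inE -def_b.
rewrite def_b meet_mask_of !sumn_points_mask_of => cardI lt_BA.
have B_hex := shuffle_blockset_hexad BB.
exists B; rewrite hexad_edgeE welter_edgeE A_hex B_hex cardI lt_BA !andbT.
rewrite IHm ?BB ?andbT; last exact: leq_trans lt_BA le_m.
by move: A_hex B_hex; rewrite !mem_hexad_game => /andP[-> _] /andP[-> _].
Qed.

(** A position of the game that is not P has a move to a P-position. Conversely, a set with a move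
    to a P-position has a larger sum than it, so its sum is also at least 21. *)
Lemma bar_P_shuffle :
  bar_P 6 shuffle_design =
  [set P : {set 'I_12} | (#|P| == 6) && (21 <= \sum_(p in P) p)].
Proof.
apply/setP => R; rewrite [RHS]inE -mem_hexad_game mem_bar_P.
apply/idP/idP => [/orP[/shuffle_design_hexad //|/exists_inP[B]]|R_hex].
  move=> /shuffle_design_hexad.
  rewrite welter_edgeE !mem_hexad_game => /andP[_ geB] /and4P[-> _ _ ltBR].
  exact: leq_trans geB (ltnW ltBR).
have [//|/=] := boolP (R \in shuffle_design).
rewrite shuffle_designE // negbK => /existsP[B /andP[]].
by rewrite hexad_edgeE => /and3P[RB _ _] DB; apply/exists_inP; exists B.
Qed.

Lemma card_bar_P_shuffle : #|bar_P 6 shuffle_design| = 905.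
Proof.
rewrite bar_P_shuffle.
transitivity (count (fun m => 21 <= sumn (points m)) (masks 12 6)).
  2: by lazy.
rewrite -card_masks; apply: eq_card => A; rewrite !inE.
by rewrite sumn_points_mask_of.
Qed.

(** * The game distribution *)

(** Applied to masks of singletons, where the default 0 is not reached. *)
Definition point (a : bitseq) : nat := head 0 (points a).

(* The pairs (p, q) such that exchanging p for q turns a into a member of
   C. *)
Definition swaps (C : seq bitseq) (a : bitseq) : seq (nat * nat) :=
  [seq (point (diff a b), point (diff b a)) |
    b <- C & (meet a b).+1 == count id a].

Definition increasing_at (w : seq nat) (pq : nat * nat) : bool :=
  nth 0 w pq.1 < nth 0 w pq.2.

Definition unreached (C : seq bitseq) (w : seq nat) (a : bitseq) : bool :=
  (a \notin C) && all (increasing_at w) (swaps C a).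

Lemma point_mask_of (n : nat) (p : 'I_n) : point (mask_of [set p]) = p.
Proof. by rewrite /point points_mask_of enum_set1. Qed.

(** Everything is pulled back along [s]: a block [B] that differs from [R] by exchanging [s p] for
    [s q] becomes a block of [C] that differs from the preimage of [R] by exchanging [p] for [q].
    There is no move from [R] to [B] iff [s p < s q]. *)
Lemma mem_bar_P_act (n k : nat) (C : seq bitseq) (s : 'S_n) (R : {set 'I_n}) :
  {subset C <= masks n k.+1} -> #|R| = k.+1 ->
  (R \notin bar_P k.+1 ('P^*^*%act (design_of n C) s)) =
  unreached C (values s) (mask_of (s @^-1: R)).
Proof.
move=> C_masks cardR; rewrite mem_bar_P negb_or mem_act_design inE.
congr (_ && _).
apply/exists_inPn/allP => [noedge _ /mapP[b + ->]|incr B DB].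
  rewrite mem_filter => /andP[+ Cb]; have := C_masks _ Cb.
  rewrite mem_masks => /andP[/eqP/mask_ofP[B0 def_b]].
  have [B def_B0] : exists B : {set 'I_n}, B0 = s @^-1: B.
    by exists (s^-1%g @^-1: B0); rewrite preimset_permKV.
  rewrite {}def_b {}def_B0 in Cb *.
  rewrite !count_mask_of meet_mask_of !diff_mask_of -preimsetI -!preimsetD.
  rewrite !card_preimset_perm cardR eqSS.
  move=> /eqP cardB /eqP cardI.
  have [p' RB] := card_diff_set1 cardR cardI.
  have [q' BR] : exists q, B :\: R = [set q].
    by apply: card_diff_set1 cardB _; rewrite setIC; exact: cardI.
  rewrite -(permKV s p') -(permKV s q') in RB BR.
  set p := (s^-1)%g p' in RB; set q := (s^-1)%g q' in BR.
  rewrite RB BR !preimset_perm1 !point_mask_of /increasing_at /= !nth_values.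
  (* The absence of a move gives only [s p <= s q]; equality is impossible because [s q] lies in [B]
     and [s p] does not. *)
  rewrite ltn_neqAle leqNgt; apply/andP; split.
    apply: contraTneq (set11 (s p)) => /val_inj eq_pq.
    have : s q \in B :\: R by rewrite BR set11.
    by rewrite -eq_pq -RB !inE => /andP[_ ->].
  have : B \in 'P^*^*%act (design_of n C) s by rewrite mem_act_design inE.
  move/noedge; apply: contra => lt_qp; apply/welter_edgeP; split=> //.
  by exists (s p), (s q).
apply/negP => /welter_edgeP[_ cardB [p' [q' [RB BR]]]].
rewrite -(permKV s p') -(permKV s q') in RB BR *.
set p := (s^-1)%g p' in RB *; set q := (s^-1)%g q' in BR *.
apply/negP; suff /incr : (val p, val q) \in swaps C (mask_of (s @^-1: R)).
  by rewrite /increasing_at /= !nth_values -leqNgt => /ltnW.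
rewrite mem_act_design inE in DB; apply/mapP; exists (mask_of (s @^-1: B)).
  rewrite mem_filter DB count_mask_of meet_mask_of -preimsetI.
  rewrite !card_preimset_perm andbT.
  by rewrite -(cardsID B R) RB cards1 addn1.
by rewrite !diff_mask_of -!preimsetD RB BR !preimset_perm1 !point_mask_of.
Qed.

(** Preimage under [s] permutes the subsets of size [k.+1], so those outside [bar_P] can be counted
    through their preimages. *)
Lemma card_bar_P_act (n k : nat) (C : seq bitseq) (s : 'S_n) :
  {subset C <= masks n k.+1} ->
  #|bar_P k.+1 ('P^*^*%act (design_of n C) s)| +
    count (unreached C (values s)) (masks n k.+1) = 'C(n, k.+1).
Proof.
move=> C_masks; set bar := bar_P _ _.
pose S := [set A : {set 'I_n} | #|A| == k.+1].
have sub_bar : bar \subset S.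
  apply/subsetP => R; rewrite mem_bar_P inE => /orP[|/exists_inP[B _]].
    rewrite mem_act_design inE => /C_masks.
    by rewrite mask_of_masks card_preimset_perm.
  by rewrite welter_edgeE => /and4P[].
rewrite -card_masks -(card_preimset _ (@preimset_perm_inj _ s)).
rewrite -[in RHS](card_ord n) -card_draws -(cardsID bar S) (setIidPr sub_bar).
congr (_ + _); apply: eq_card => R.
rewrite [RHS]in_setD [R \in S]inE 2![LHS]inE card_preimset_perm andbC.
case: eqP => [cardR|_]; last by rewrite !andbF.
by rewrite mem_bar_P_act.
Qed.

Definition late_pair (pq : nat * nat) : bool := 5 <= minn pq.1 pq.2.

(** One list for each of the 51 sets that are not ruled out, with its pairs inside 5..11; its other
    pairs are increasing and stay so under H. *)
Definition shuffle_constraints : seq (seq (nat * nat)) := Eval lazy in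
  [seq [seq pq <- swaps shuffle_blocks a | late_pair pq] | a <- masks 12 6 &
    (a \notin shuffle_blocks) &&
    all (fun pq => late_pair pq || (pq.1 < pq.2)) (swaps shuffle_blocks a)].

Definition num_unreached (w : seq nat) : nat :=
  count (all (increasing_at w)) shuffle_constraints.

Lemma shuffle_constraintsE :
  shuffle_constraints =
  [seq [seq pq <- swaps shuffle_blocks a | late_pair pq] | a <- masks 12 6 &
    (a \notin shuffle_blocks) &&
    all (fun pq => late_pair pq || (pq.1 < pq.2)) (swaps shuffle_blocks a)].
Proof. by lazy. Qed.

Lemma swaps_lt12 :
  all (fun a =>
    all (fun pq => (pq.1 < 12) && (pq.2 < 12)) (swaps shuffle_blocks a))
    (masks 12 6).
Proof. by lazy. Qed.

(** Entry [m] is the number of elements of H for which exactly [m] of the 51 conjunctions hold. It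
    belongs to the size [924 - m], where 924 is the number of 6-subsets, so the distribution appears
    in reverse. *)
Definition unreached_histogram : seq nat :=
  [:: 0; 0; 0; 0; 0; 0; 0; 0;
      1; 115; 532; 939; 1237; 1012; 650; 351; 150; 42; 10; 1].

Lemma num_unreached_histogram :
  foldl incr_nth [::] [seq num_unreached w | w <- late_values] =
  unreached_histogram.
Proof. by lazy. Qed.

Lemma late_values_stab :
  all (fun w => (w == iota 0 12) ||
    ~~ all (fun b => relabel w b \in shuffle_blocks) shuffle_blocks)
    late_values.
Proof. by lazy. Qed.

Arguments num_unreached : simpl never.

Lemma nth_foldl_incr_nth (h s : seq nat) (n : nat) :
  nth 0 (foldl incr_nth h s) n = nth 0 h n + count_mem n s.
Proof.
elim: s h => [|x s IHs] h /=; first by rewrite addn0.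
by rewrite IHs nth_incr_nth addnCA addnA.
Qed.

Lemma all_filter_if (T : Type) (P f g : pred T) (s : seq T) :
  all (fun x => if P x then f x else g x) s =
  all f [seq x <- s | P x] && all (fun x => P x || g x) s.
Proof.
elim: s => //= x s ->; case: (P x) => /=; first by rewrite andbA.
by rewrite andbCA.
Qed.

Lemma late_stable (s : 'S_12) (i : 'I_12) :
  s \in Sym late -> (4 < s i) = (4 < i).
Proof. by rewrite inE => /(perm_closed i); rewrite !inE. Qed.

(** An element of H fixes 0..4 and maps larger points to points above 4, so it keeps the order of
    any pair that meets 0..4. *)
Lemma increasing_at_late (s : 'S_12) (p q : 'I_12) : s \in Sym late ->
  increasing_at (values s) (val p, val q) =
  (if late_pair (val p, val q) then increasing_at (values s) (val p, val q)
   else p < q).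
Proof.
move=> late_s; case: ifP => //.
rewrite /late_pair /increasing_at /= !nth_values.
have := late_stable p late_s; have := late_stable q late_s.
have := @late_fix _ p late_s; have := @late_fix _ q late_s.
rewrite leq_min; case: (ltnP 4 p) => ltp; case: (ltnP 4 q) => ltq //=.
- by move=> -> // _; lia.
- by move=> _ -> //; lia.
- by move=> -> // -> //.
Qed.

Lemma count_unreached (s : 'S_12) : s \in Sym late ->
  count (unreached shuffle_blocks (values s)) (masks 12 6) =
  num_unreached (values s).
Proof.
move=> late_s.
rewrite /num_unreached shuffle_constraintsE count_map count_filter.
apply: eq_in_count => a a6; rewrite /unreached /= andbCA; congr (_ && _).
rewrite -all_filter_if; apply: eq_in_all => -[p q] pq_a.
have /andP[lt_p lt_q] := allP (allP swaps_lt12 a a6) _ pq_a.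
exact: (increasing_at_late (Ordinal lt_p) (Ordinal lt_q)).
Qed.

Lemma shuffle_blocks_masks : {subset shuffle_blocks <= masks 12 6}.
Proof.
move=> b /(allP shuffle_blocks_hexads).
by rewrite inE mem_filter => /andP[].
Qed.

Lemma card_bar_P_late (s : 'S_12) : s \in Sym late ->
  #|bar_P 6 ('P^*^*%act shuffle_blockset s)| + num_unreached (values s) = 924.
Proof.
move=> late_s; rewrite -count_unreached // card_bar_P_act //.
exact: shuffle_blocks_masks.
Qed.

Lemma shuffle_stab (s : 'S_12) : s \in Sym late ->
  'P^*^*%act shuffle_blockset s = shuffle_blockset -> s = 1%g.
Proof.
move=> late_s fix_s; apply: values_inj.
have -> : values (1 : 'S_12)%g = iota 0 12.
  by rewrite -val_enum_ord /values; apply: eq_map => i; rewrite perm1.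
have := allP late_values_stab _ (values_late late_s).
case/orP=> [/eqP //|/allPn[b b_blk]].
have := shuffle_blocks_masks b_blk; rewrite mem_masks.
move=> /andP[/eqP/mask_ofP[B def_b] _].
rewrite def_b relabel_mask_of in b_blk *.
have : B \in shuffle_blockset by rewrite inE.
by rewrite -{1}fix_s mem_act_design inE => ->.
Qed.

Lemma shuffle_act_inj :
  {in Sym late &, injective (fun s : 'S_12 => 'P^*^*%act shuffle_blockset s)}.
Proof.
move=> s t late_s late_t eq_st; apply: (mulIg t^-1%g); rewrite mulgV.
apply: shuffle_stab; first by rewrite groupM ?groupV.
by rewrite actM eq_st actK.
Qed.

(** Each image of [D] is again a Steiner system, so [steiner_shuffle] applies to it: the orbit under
    all permutations is an orbit under H. *)
Lemma design_orbit_shuffle D : is_steiner_system 5 6 D ->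
  design_orbit D = [set 'P^*^*%act shuffle_blockset s | s in Sym late].
Proof.
move=> steinerD; apply/setP => E; apply/imsetP/imsetP => [[t _ ->]|[s _ ->]].
  have [s late_s ->] := steiner_shuffle (steiner_act t steinerD).
  by exists s^-1%g; rewrite ?groupV // actK.
have [r _ ->] := steiner_shuffle steinerD.
by exists (r * s)%g; rewrite ?inE // actM.
Qed.

Lemma card_set_late (P : pred (seq nat)) :
  #|[set s in Sym late | P (values s)]| = count P late_values.
Proof.
rewrite -(seq.permP perm_late_values) count_map cardE -size_filter; congr size.
rewrite /enum_mem -filter_predI; apply: eq_filter => s.
by rewrite !inE andbC.
Qed.

(** Since H acts regularly, systems of value [n] correspond to elements of H with [924 - n] true
    conjunctions, and these are read off the histogram. *)
Lemma game_distribution_shuffle (D : {set {set 'I_12}}) n :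
  is_steiner_system 5 6 D ->
  game_distribution 6 D n =
  if n <= 924 then
    nth 0 unreached_histogram (924 - n)
  else 0.
Proof.
move=> steinerD; rewrite /game_distribution design_orbit_shuffle //.
have -> : [set D' in [set 'P^*^*%act shuffle_blockset s | s in Sym late] |
            #|bar_P 6 D'| == n] =
    (fun s => 'P^*^*%act shuffle_blockset s) @:
      [set s in Sym late | num_unreached (values s) + n == 924].
  apply/setP => E; rewrite inE; apply/andP/imsetP => [[]|[s]].
    case/imsetP=> s late_s -> /eqP cardE; exists s; rewrite // inE late_s.
    by rewrite -(card_bar_P_late late_s) cardE addnC /=.
  rewrite inE => /andP[late_s]; rewrite -(card_bar_P_late late_s).
  rewrite addnC eqn_add2r => eq_n ->.
  by rewrite eq_sym; split=> //; apply: imset_f.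
rewrite card_in_imset; last first.
  by apply: sub_in2 shuffle_act_inj => s; rewrite inE => /andP[].
rewrite (card_set_late (fun w => num_unreached w + n == 924)).
case: leqP => [le_n|gt_n]; last first.
  apply/eqP; rewrite -leqn0 leqNgt -has_count; apply/hasPn => w _ /=.
  by move: (num_unreached w) => x; lia.
rewrite -num_unreached_histogram nth_foldl_incr_nth nth_nil add0n.
rewrite [in RHS](count_map num_unreached).
by apply: eq_count => w /=; move: (num_unreached w) => x; lia.
Qed.

Theorem theorem4p3 (D : {set {set 'I_12}}) (steinerD : is_steiner_system 5 6 D) :
  #|design_orbit D| = 5040 /\
  (forall n : nat, game_distribution 6 D n <> 0 <-> 905 <= n <= 916) /\
  (game_distribution 6 D 905 = 1 /\
   game_distribution 6 D 906 = 10 /\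
   game_distribution 6 D 907 = 42 /\
   game_distribution 6 D 908 = 150 /\
   game_distribution 6 D 909 = 351 /\
   game_distribution 6 D 910 = 650 /\
   game_distribution 6 D 911 = 1012 /\
   game_distribution 6 D 912 = 1237 /\
   game_distribution 6 D 913 = 939 /\
   game_distribution 6 D 914 = 532 /\
   game_distribution 6 D 915 = 115 /\
   game_distribution 6 D 916 = 1) /\
  induced_subgraph (welter_game 12 6) (bar_P 6 shuffle_design) = hexad_game /\
  (shuffle_design \in design_orbit D /\ #|bar_P 6 shuffle_design| = 905) /\
  (forall D' : {set {set 'I_12}}, D' \in design_orbit D ->
     #|bar_P 6 D'| = 905 -> D' = shuffle_design) /\
  (forall D' : {set {set 'I_12}}, D' \in design_orbit D -> 905 <= #|bar_P 6 D'|).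
Proof.
have distE n := game_distribution_shuffle n steinerD.
have supp n : game_distribution 6 D n <> 0 <-> 905 <= n <= 916.
  rewrite distE; case: (leqP n 924) => [le_n|gt_n]; last first.
    by split=> // /andP[_ /(leq_trans gt_n)].
  (* The nonzero entries of the histogram are those with index 8 to 19. *)
  have -> : (905 <= n <= 916) = (8 <= 924 - n < 20) by lia.
  move: (924 - n) => m; have [lt_m|ge_m] := ltnP m 20; last first.
    by rewrite nth_default // andbF; split.
  have /allP/(_ m) :
    all (fun m => (nth 0 unreached_histogram m != 0) == (8 <= m)) (iota 0 20).
    by [].
  rewrite mem_iota add0n lt_m !andbT => /(_ isT)/eqP <-.
  by split=> /eqP.
have shuffle_orbit : shuffle_design \in design_orbit D.
  rewrite shuffle_design_blocks design_orbit_shuffle //.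
  by apply/imsetP; exists 1%g; rewrite ?group1 ?act1.
have mem_dist D' : D' \in design_orbit D ->
    D' \in [set E in design_orbit D | #|bar_P 6 E| == #|bar_P 6 D'|].
  by move=> orbD'; rewrite inE orbD' eqxx.
split.
  rewrite design_orbit_shuffle // (card_in_imset shuffle_act_inj).
  by rewrite card_Sym card_late.
split=> //; split; first by rewrite !distE.
split; first by rewrite bar_P_shuffle.
split; first by split=> //; apply: card_bar_P_shuffle.
split=> [D' orbD' cardD'|D' orbD'].
  (* The value 1 at 905 says that the systems attaining 905 form a singleton, and the shuffle design
     is among them. *)
  have /eqP/cards1P[E def_E] : game_distribution 6 D 905 = 1 by rewrite distE.
  have := mem_dist _ orbD'; have := mem_dist _ shuffle_orbit.
  by rewrite cardD' card_bar_P_shuffle def_E !inE => /eqP-> /eqP.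
(* A value that is attained has nonzero frequency, so the support of the distribution bounds it from
   below. *)
suff /supp/andP[] : game_distribution 6 D #|bar_P 6 D'| <> 0 by [].
by apply/eqP; rewrite -lt0n; apply/card_gt0P; exists D'; apply: mem_dist.
Qed.
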